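(* Let $G$ be a (reflexive) oriented graph containing a directed cycle of length larger than $2$, that is, there are $n\ge 3$ distinct vertices $x_0,\dots,x_{n-1}$ of $G$ such that $(x_i,x_{i+1})$ is an arc for every $i$ (indices modulo $n$). Then $G$ cannot be embedded into any absolute retract in the category of oriented graphs.
   Context: **Graphs.** All directed graphs are reflexive: a directed graph is a pair $G=(V,\mathcal E)$ with $\mathcal E\subseteq V\times V$ and $(x,x)\in\mathcal E$ for all $x\in V$; elements of $\mathcal E$ are arcs. It is *oriented* if $(x,y),(y,x)\in\mathcal E$ implies $x=y$. A *homomorphism* from $G$ to $G'$ is a map $V(G)\to V(G')$ sending arcs to arcs (possibly loops). An *embedding* from $G$ to $G'$ is an injective map $f:V(G)\to V(G')$ such that $(x,y)$ is an arc of $G$ if and only if $(f(x),f(y))$ is an arc of $G'$. **Zigzag distance.** For a finite word $u=a_0\cdots a_{n-1}$ over $\Lambda=\{+,-\}$, $Z_u$ is the reflexive oriented graph on $\{0,\dots,n\}$ whose non-loop arcs are $(i,i+1)$ if $a_i=+$ and $(i+1,i)$ if $a_i=-$, for $0\le i\le n-1$. The zigzag distance $d_G(x,y)$ is the set of all words $u$ (including possibly the empty word) for which there is a homomorphism from $Z_u$ to $G$ sending $0$ to $x$ and $|u|$ to $y$. An *isometry* from $G$ to $G'$ is a map $f:V(G)\to V(G')$ with $d_{G'}(f(x),f(y))=d_G(x,y)$ for all $x,y\in V(G)$. **Absolute retract.** An oriented graph $R$ is an absolute retract in the category of oriented graphs if for every oriented graph $H$ and every isometry $f$ from $R$ to $H$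 there is a homomorphism $g$ from $H$ to $R$ with $g\circ f=\mathrm{id}_{V(R)}$. *)

(* Defs.v *)
From mathcomp Require Import all_boot.

Set Implicit Arguments.
Unset Strict Implicit.
Unset Printing Implicit Defensive.

(* Vertex types are arbitrary: graphs may be infinite or empty. *)
Record digraph := Digraph {
  vertex :> Type;
  arc : vertex -> vertex -> Prop;
  arc_refl : forall x, arc x x
}.

Definition oriented (G : digraph) : Prop :=
  forall x y : G, arc x y -> arc y x -> x = y.

Definition homomorphism (G G' : digraph) (f : G -> G') : Prop :=
  forall x y : G, arc x y -> arc (f x) (f y).

Definition embedding (G G' : digraph) (f : G -> G') : Prop :=
  injective f /\ forall x y : G, arc x y <-> arc (f x) (f y).

Inductive letter := Plus | Minus.

Definition word := seq letter.

(* For i, j <= size u, the equation j = i.+1 forces i < size u, so the default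
   value of nth is never reached. *)
Definition zigzag_arc (u : word) (i j : 'I_(size u).+1) : Prop :=
  [\/ i = j,
      j = i.+1 :> nat /\ nth Plus u i = Plus
    | i = j.+1 :> nat /\ nth Plus u j = Minus].

Lemma zigzag_arc_refl (u : word) (i : 'I_(size u).+1) : zigzag_arc i i.
Proof. by constructor 1. Qed.

Definition zigzag (u : word) : digraph :=
  @Digraph 'I_(size u).+1 (@zigzag_arc u) (@zigzag_arc_refl u).

(* The zigzag distance is a set of words, given as a predicate. *)
Definition zigzag_dist (G : digraph) (x y : G) (u : word) : Prop :=
  exists h : zigzag u -> G,
    [/\ homomorphism h, h (ord0 : 'I_(size u).+1) = x
      & h (ord_max : 'I_(size u).+1) = y].

Definition isometry (G G' : digraph) (f : G -> G') : Prop :=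
  forall (x y : G) (u : word), zigzag_dist (f x) (f y) u <-> zigzag_dist x y u.

Definition absolute_retract (R : digraph) : Prop :=
  oriented R /\
  forall H : digraph, oriented H ->
  forall f : R -> H, isometry f ->
  exists g : H -> R, homomorphism g /\ cancel f g.

(* ordS is the cyclic successor on 'I_n. *)
Definition directed_cycle (G : digraph) (n : nat) (x : 'I_n -> G) : Prop :=
  injective x /\ forall i : 'I_n, arc (x i) (x (ordS i)).

(* Main.v *)
From mathcomp Require Import all_boot.
From mathcomp Require Import zify.
From Stdlib Require Import Classical.
Require Import Defs.

(** Write [R] for an absolute retract containing a directed cycle.

    Suppose first that [R] has a directed 3-cycle [a -> b -> c -> a]. Every word
    of length at least 2 lies in the distance between any two of its vertices,
    so gluing any new vertices to [a] and [c] gives an isometric extension of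
    [R], as soon as it is oriented. One glues a copy of the power set of [R]
    together with auxiliary vertices such that identifying two of its elements
    would force [a = c]; a retraction would then inject the power set of [R]
    into [R].

    Hence every closed directed walk of length 3 in [R] is constant. Let now
    [x0 -> x1] be an arc with a directed path of length [M >= 2] from [x1] back
    to [x0]. Glue to [R] the integers, with the arcs [i + 1 -> i] and
    [i -> i + 2], where [x0] plays the role of [0] and [x1] that of [M]. This is
    isometric since it takes [M] steps to descend from [M] to [0]. Consecutive
    integers lie on a common 3-cycle, so a retraction identifies all of them,
    which yields [x0 = x1]. *)

Set Implicit Arguments.
Unset Strict Implicit.
Unset Printing Implicit Defensive.

(** * Walks spelled by words *)

Definition step (G : digraph) (s : letter) (x y : G) : Prop :=
  if s is Plus then arc x y else arc y x.

(** The zigzag distance by recursion on the word, so that walks can be concatenated; see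
    [zigzag_distP]. *)
Fixpoint walk (G : digraph) (u : word) (x y : G) : Prop :=
  if u is s :: v then exists z, step s x z /\ walk v z y else x = y.

Definition flip (s : letter) : letter := if s is Plus then Minus else Plus.

Section Walks.

Variable G : digraph.

Lemma step_refl s (x : G) : step s x x.
Proof. by case: s; apply: arc_refl. Qed.

Lemma walk_refl u (x : G) : walk u x x.
Proof. by elim: u => //= s u IHu; exists x; split=> //; apply: step_refl. Qed.

Lemma walk_cat u v (x y z : G) : walk u x y -> walk v y z -> walk (u ++ v) x z.
Proof.
elim: u x => [|s u IHu] x /=; first by move=> ->.
by case=> t [xt ty] yz; exists t; split=> //; apply: IHu.
Qed.

Lemma walk1 s (x y : G) : step s x y -> walk [:: s] x y.
Proof. by exists y. Qed.

Lemma walk_rcons u s (x y z : G) :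
  walk u x y -> step s y z -> walk (rcons u s) x z.
Proof. by rewrite -cats1 => xy /walk1; apply: walk_cat. Qed.

Lemma walk_seq (f : nat -> G) u :
  (forall i, i < size u -> step (nth Plus u i) (f i) (f i.+1)) ->
  walk u (f 0) (f (size u)).
Proof.
elim: u f => [|s u IHu] f //= f_step; exists (f 1); split; first exact: (f_step 0).
by apply: (IHu (fun i => f i.+1)) => i; apply: (f_step i.+1).
Qed.

Lemma seq_of_walk u (x y : G) : walk u x y ->
  exists f : nat -> G, [/\ f 0 = x, f (size u) = y &
    forall i, i < size u -> step (nth Plus u i) (f i) (f i.+1)].
Proof.
elim: u x => [|s u IHu] x /=; first by move=> ->; exists (fun=> y).
case=> z [xz /IHu[f [f0 fu f_step]]].
exists (fun i => if i is j.+1 then f j else x).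
by split=> // -[|i] /=; [rewrite f0 | apply: f_step].
Qed.

Lemma zigzag_distP (x y : G) u : zigzag_dist x y u <-> walk u x y.
Proof.
split=> [[h [hom_h <- <-]]|/seq_of_walk[f [<- <- f_step]]].
  have -> : ord0 = inord 0 :> 'I_(size u).+1 by apply: val_inj; rewrite /= inordK.
  have -> : ord_max = inord (size u) :> 'I_(size u).+1.
    by apply: val_inj; rewrite /= inordK.
  (* Only indices up to [size u] occur here, so [inord] never takes its default value. *)
  apply: (walk_seq (f := fun i => h (inord i))) => i lt_i.
  case s_i: (nth _ _ _) => /=; apply: hom_h.
    by constructor 2; rewrite !inordK // ltnS ltnW.
  by constructor 3; rewrite !inordK // ltnS ltnW.
exists (fun i : 'I_(size u).+1 => f i); split=> // i j /= [<-|[ij s_i]|[ji s_j]].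
- exact: arc_refl.
- have lt_i : i < size u by rewrite -ltnS -ij ltn_ord.
  by have := f_step i lt_i; rewrite s_i /= -ij.
- have lt_j : j < size u by rewrite -ltnS -ji ltn_ord.
  by have := f_step j lt_j; rewrite s_j /= -ji.
Qed.

Lemma letter_dec (s : letter) (u : word) :
  List.In s u \/ u = nseq (size u) (flip s).
Proof.
elim: u => [|t u [s_u|u_flip]] /=; [by right | by left; right |].
by rewrite {2}u_flip; case: s t {u_flip} => -[]; auto.
Qed.

Lemma walk_step s u (x y : G) : List.In s u -> step s x y -> walk u x y.
Proof.
move=> + xy; elim: u => //= t u IHu [->|/IHu xuy].
  by exists y; split=> //; apply: walk_refl.
by exists x; split=> //; apply: step_refl.
Qed.

(** If [s] occurs in [u], cross the arc there and wait at all other letters. Otherwise [u] repeats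
    [flip s] at least [k] times: follow the return path, then wait at [y]. *)
Lemma walk_arc_or_return s k u (x y : G) :
  step s x y -> walk (nseq k (flip s)) x y ->
  List.In s u \/ k <= size u -> walk u x y.
Proof.
move=> xy xky; case: (letter_dec s u) => [s_u _|-> Dku]; first exact: walk_step xy.
case: Dku => [|]; last rewrite size_nseq => le_ku.
  by move=> s_u; apply: walk_step xy.
rewrite -(subnKC le_ku) nseqD; apply: walk_cat xky _.
exact: walk_refl.
Qed.

End Walks.

(** * Gluing new vertices to a graph *)

Section Attach.

Variables (R : digraph) (N : Type) (arcN : N -> N -> Prop).
Variables (into : R -> N -> Prop) (outof : N -> R -> Prop).
Hypothesis arcN_refl : forall p, arcN p p.

Definition attach_arc (x y : R + N) : Prop :=
  match x, y with
  | inl r, inl r' => arc r r'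
  | inl r, inr p => into r p
  | inr p, inl r => outof p r
  | inr p, inr q => arcN p q
  end.

Lemma attach_arc_refl x : attach_arc x x.
Proof. by case: x => [r|p] /=; [apply: arc_refl | apply: arcN_refl]. Qed.

Definition attach : digraph := Digraph attach_arc_refl.

Lemma attach_oriented :
  oriented R -> (forall p q, arcN p q -> arcN q p -> p = q) ->
  (forall r p, into r p -> outof p r -> False) -> oriented attach.
Proof.
move=> oR oN oRN [r|p] [r'|q] /=.
- by move=> rr' r'r; rewrite (oR _ _ rr' r'r).
- by move=> /oRN/[apply].
- by move=> /[swap] /oRN/[apply].
- by move=> pq qp; rewrite (oN _ _ pq qp).
Qed.

(* [Q a v p] over-approximates the words [v] of the walks from [a] to [p]
   whose vertices after [a] are all new. *)
Lemma attach_isometry (Q : R -> word -> N -> Prop) :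
  (forall s a p, step s (inl a : attach) (inr p) -> Q a [:: s] p) ->
  (forall s a v p q, Q a v p -> step s (inr p : attach) (inr q) ->
     Q a (rcons v s) q) ->
  (forall s a v p b, Q a v p -> step s (inr p : attach) (inl b) ->
     walk (rcons v s) a b) ->
  isometry (inl : R -> attach).
Proof.
move=> Qenter Qmove Qleave x y u; rewrite !zigzag_distP; split; last first.
  elim: u x => [|s u IHu] x /=; first by move=> ->.
  by case=> z [xz /IHu zy]; exists (inl z); split=> //; case: s xz.
(* Invariant of a walk from [x] that has read [w]: excursions that came back to [R] are replaced by
   walks in [R], and [a] is the vertex where the current one left [R]. *)
pose D w (h : attach) := match h with
  | inl r => walk w x r
  | inr p => exists a w1 w2, [/\ w = w1 ++ w2, walk w1 x a & Q a w2 p]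
  end.
have D_step w s h h' : D w h -> step s h h' -> D (rcons w s) h'.
  case: h h' => [r|p] [r'|q] /=.
  - by move=> xr rr'; apply: walk_rcons xr _; case: s rr'.
  - by move=> xr rq; exists r, w, [:: s]; rewrite cats1; split=> //; apply: Qenter.
  - case=> a [w1 [w2 [-> xa Qp]]] pr'; rewrite rcons_cat.
    by apply: walk_cat xa _; apply: Qleave pr'.
  - case=> a [w1 [w2 [-> xa Qp]]] pq; exists a, w1, (rcons w2 s).
    by rewrite rcons_cat; split=> //; apply: Qmove pq.
have D_walk w h : D w h -> walk u h (inl y : attach) -> D (w ++ u) (inl y).
  elim: u w h => [|s u IHu] w h Dh; first by rewrite cats0 => <-.
  by case=> z [hz zy]; rewrite -cat_rcons; apply: IHu zy; apply: D_step hz.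
by move=> xy; apply: (D_walk [::] (inl x)) xy.
Qed.

End Attach.

(** * Directed 3-cycles *)

Lemma Cantor_no_injection (T : Type) (i : (T -> Prop) -> T) : ~ injective i.
Proof.
move=> i_inj; pose D t := exists2 P, i P = t & ~ P t.
have nD : ~ D (i D) by move=> DD; case: (DD) => P /i_inj ->.
by apply: (nD); exists D.
Qed.

Section ThreeCycle.

Variables (R : digraph) (a b c : R).

(** For distinct [P] and [Q], [Link P Q] is the midpoint of a directed path from [Base P] to
    [Base Q], which collapses in an oriented graph once its ends are identified. *)
Inductive power_gadget :=
  | Base of R -> Prop
  | Link of (R -> Prop) & (R -> Prop).

Definition gadget_arc (p q : power_gadget) : Prop :=
  match p, q with
  | Base P, Link P' Q => P = P' /\ P' <> Q
  | Link P Q, Base Q' => Q = Q' /\ P <> Q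
  | _, _ => p = q
  end.

Lemma gadget_arc_refl p : gadget_arc p p.
Proof. by case: p. Qed.

Definition gadget_into (r : R) (p : power_gadget) : Prop :=
  if p is Link _ _ then r = a else False.

Definition gadget_outof (p : power_gadget) (r : R) : Prop :=
  if p is Base _ then r = a \/ r = c else False.

Let H : digraph := attach gadget_into gadget_outof gadget_arc_refl.

Lemma gadget_oriented : oriented R -> oriented H.
Proof.
move=> oR; apply: attach_oriented => //; last by move=> r [].
case=> [P|P Q] [P'|P' Q'] //=.
  by case=> <- nPQ' [PQ' _]; case: nPQ'.
by case=> -> nPQ [QP _]; case: nPQ.
Qed.

Lemma gadget_isometry :
  arc a b -> arc b c -> arc c a -> isometry (inl : R -> H).
Proof.
move=> ab bc ca.
pose C r := r = a \/ r = c.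
have walkC v r r' : 1 < size v -> C r -> C r' -> walk v r r'.
  move=> v2 [->|->] [->|->]; try exact: walk_refl.
    apply: (@walk_arc_or_return _ Minus 2) => //; last by right.
    by exists b; split=> //; exists c.
  apply: (@walk_arc_or_return _ Plus 2) => //; last by right.
  by exists b; split=> //; exists a.
(* Coming back to [R] reads one more letter, so the word of an excursion has length at least 2. *)
apply: (attach_isometry (Q := fun r v _ => C r /\ 0 < size v)).
- by rewrite /C => -[] r [P|P Q] //= Cr; auto.
- by move=> s r v p q [Cr _] _; rewrite size_rcons.
- move=> s r v p r' [Cr v0] pr'; apply: walkC => //; first by rewrite size_rcons.
  by rewrite /C; case: s p pr' => -[P|P Q] //=; auto.
Qed.

End ThreeCycle.

Lemma absolute_retract_closed3 (R : digraph) (a b c : R) :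
  absolute_retract R -> arc a b -> arc b c -> arc c a -> a = c.
Proof.
case=> oR retR ab bc ca; apply: NNPP => neq_ac.
have [g [g_hom gK]] := retR _ (gadget_oriented oR) _ (gadget_isometry ab bc ca).
apply: (@Cantor_no_injection R (fun P => g (inr (Base P)))) => P Q eqPQ.
apply: NNPP => neqPQ.
have PL : arc (g (inr (Base P))) (g (inr (Link P Q))) by apply: g_hom.
have LP : arc (g (inr (Link P Q))) (g (inr (Base P))).
  by rewrite eqPQ; apply: g_hom.
have aL : arc a (g (inr (Link P Q))) by rewrite -[a in arc a]gK; apply: g_hom.
have Pa : arc (g (inr (Base P))) a by rewrite -[a in arc _ a]gK; apply: g_hom; left.
have Pc : arc (g (inr (Base P))) c by rewrite -[c in arc _ c]gK; apply: g_hom; right.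
(* The common image of bases and link has arcs from and to [a], hence is [a]; its arc to [c] then
   reverses [c -> a]. *)
have eqPa : g (inr (Base P)) = a.
  by apply: (oR _ _ Pa); rewrite (oR _ _ PL LP).
by apply: neq_ac; apply: (oR) ca; rewrite -{1}eqPa.
Qed.

(** * Arcs with a directed return path *)

Section Band.

Variables (R : digraph) (x y : R) (M : nat).

Definition band_arc (i j : nat) : Prop := [\/ i = j, i = j.+1 | j = i.+2].

Lemma band_arc_refl i : band_arc i i.
Proof. by constructor 1. Qed.

(* The integers [0] and [M] stay as new vertices beside [x] and [y]. *)
Definition band_into (r : R) (i : nat) : Prop :=
  r = x /\ i = 2 \/ r = y /\ M = i.+1.

Definition band_outof (i : nat) (r : R) : Prop :=
  r = x /\ i = 1 \/ r = y /\ M = i.+2.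

Let H : digraph := attach band_into band_outof band_arc_refl.

Lemma band_oriented : oriented R -> x <> y -> oriented H.
Proof.
move=> oR neq_xy; apply: attach_oriented => //.
  by move=> i j [] ? []; lia.
by move=> r i [] [? ?] [] [? ?]; subst; lia || exact: neq_xy.
Qed.

Lemma band_isometry : arc x y ->
  walk (nseq M Minus) x y -> walk (nseq M Plus) y x ->
  isometry (inl : R -> H).
Proof.
move=> xy xMy yMx.
(* Each [Minus] climbs by at most 1 and each [Plus] descends by at most 1. So an excursion between
   [x] and [y] reads the letter that crosses the arc [x -> y], or at least [M] letters. *)
pose Q r v i := r = x /\ (List.In Plus v \/ i <= size v) \/
                r = y /\ (List.In Minus v \/ M <= size v + i).
have in_rcons s v t : List.In t (rcons v s) <-> List.In t v \/ s = t.
  by rewrite -cats1 List.in_app_iff /=; tauto.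
have walk_xy v : List.In Plus v \/ M <= size v -> walk v x y.
  exact: walk_arc_or_return.
have walk_yx v : List.In Minus v \/ M <= size v -> walk v y x.
  exact: walk_arc_or_return.
apply: (attach_isometry (Q := Q)).
- move=> [] r i /= [] [-> Di]; rewrite /Q /=; [left|right|left|right]; split=> //.
  + by left; left.
  + by right; lia.
  + by right; lia.
  + by left; left.
- move=> s r v i j + ij; rewrite /Q !in_rcons size_rcons.
  by case=> [] [-> [v_s|le_v]]; [left|left|right|right]; split; auto;
     case: s ij => ij; auto; right; case: ij; lia.
- move=> s r v i r' Qi ir'.
  by case: Qi => [] [-> Qi]; case: s ir' => /= -[] [-> Di];
     try exact: walk_refl; (apply: walk_xy || apply: walk_yx);
     rewrite in_rcons size_rcons; case: Qi => Qi; auto; right; lia.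
Qed.

End Band.

Lemma absolute_retract_arc_return (R : digraph) (x y : R) (M : nat) :
  absolute_retract R -> 1 < M -> arc x y ->
  walk (nseq M Minus) x y -> walk (nseq M Plus) y x -> x = y.
Proof.
move=> absR M_gt1 xy xMy yMx; apply: NNPP => neq_xy; case: (absR) => oR retR.
have [g [g_hom gK]] :=
  retR _ (band_oriented (M := M) oR neq_xy) _ (band_isometry xy xMy yMx).
pose h i := g (inr i).
have outx : arc x (h 2) by rewrite -[x in arc x]gK; apply: g_hom; left.
have inx : arc (h 1) x by rewrite -[x in arc _ x]gK; apply: g_hom; left.
have outy : arc y (h M.-1).
  by rewrite -[y in arc y]gK; apply: g_hom; right; split=> //; lia.
have iny : arc (h M.-2) y.
  by rewrite -[y in arc _ y]gK; apply: g_hom; right; split=> //; lia.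
have down i : arc (h i.+1) (h i) by apply: g_hom; constructor 2.
have up i : arc (h i) (h i.+2) by apply: g_hom; constructor 3.
have h_const i : h i = h 0.
  elim: i => // i <-.
  by rewrite (absolute_retract_closed3 absR (up i) (down _) (down i)).
apply: neq_xy; transitivity (h 0).
  (* The closed walk [x -> h 2 -> h 1 -> x] gives [x]; for [y], the constant value of [h] has arcs
     to and from [y]. *)
  by rewrite -(h_const 1); apply: absolute_retract_closed3 absR outx (down 1) inx.
apply: oR; first by rewrite -(h_const M.-2).
by rewrite -(h_const M.-1).
Qed.

Lemma walk_nseq_path (G : digraph) (f : nat -> G) i k :
  (forall j, arc (f j) (f j.+1)) ->
  walk (nseq k Plus) (f i) (f (i + k)) /\ walk (nseq k Minus) (f (i + k)) (f i).
Proof.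
move=> f_arc; elim: k => [|k [IHp IHm]]; first by rewrite addn0.
rewrite addnS; split; last by exists (f (i + k)); split=> //; apply: f_arc.
by rewrite -addn1 nseqD; apply: walk_cat IHp _; apply: walk1; apply: f_arc.
Qed.

Theorem mainTheorem3 (G : digraph) (hG : oriented G)
    (hcycle : exists (n : nat) (x : 'I_n -> G), 3 <= n /\ directed_cycle x)
    (R : digraph) (hR : absolute_retract R) :
  ~ exists f : G -> R, embedding f.
Proof.
case=> f [f_inj f_arc]; case: hcycle => n [x [n_ge3 [x_inj x_arc]]].
have n_gt0 : 0 < n by lia.
pose idx i : 'I_n := Ordinal (ltn_pmod i n_gt0).
pose z i := f (x (idx i)).
have z_arc i : arc (z i) (z i.+1).
  have -> : z i.+1 = f (x (ordS (idx i))).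
    by congr (f (x _)); apply: val_inj; rewrite /= -addn1 -modnDml addn1.
  by apply/f_arc/x_arc.
(* The cycle without the arc [z 0 -> z 1] is the return path; its length [n.-1] is at least 2. *)
have [z_plus z_minus] := walk_nseq_path 1 n.-1 z_arc.
have zn : z (1 + n.-1) = z 0.
  by congr (f (x _)); apply: val_inj; rewrite /= add1n prednK // modnn mod0n.
rewrite zn in z_plus z_minus.
have : z 0 = z 1.
  by apply: absolute_retract_arc_return z_minus z_plus => //; lia.
move=> /f_inj/x_inj/(congr1 val) /=.
by rewrite mod0n modn_small //; lia.
Qed.
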